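(* An oracle that solves the generalized HomSP for $(S_A,S_B)$ and the $O_B$-MSP for $S_B$ is sufficient to break key establishment Protocol 2.
   Context: Let $L$ be a set with non-empty families $O_A,O_B$ of binary operations such that $x*_\alpha(y*_\beta z)=(x*_\alpha y)*_\beta(x*_\alpha z)$ and $x*_\beta(y*_\alpha z)=(x*_\beta y)*_\alpha(x*_\beta z)$ for all $x,y,z\in L$, $*_\alpha\in O_A$, $*_\beta\in O_B$. For a family $O$ of operations, $T_O(y_1,\ldots,y_k)$ denotes the evaluation of a planar rooted binary tree with leaves labelled $y_1,\ldots,y_k$ and each internal vertex labelled by an operation in $O$ (this labelling is part of the data), and $\langle y_1,\ldots,y_k\rangle_O$ is the set of all such evaluations with leaves in $\{y_1,\ldots,y_k\}$. For $x=(x_1,\ldots,x_k)\in L^k$ and a vector of operations $o=( *_1,\ldots,*_k)$ put $\phi_{(x,o)}(y)=x_k*_k(x_{k-1}*_{k-1}\cdots(x_2*_2(x_1*_1y))\cdots)$. Protocol 2: public elements $s_1,\ldots,s_m,t_1,\ldots,t_n\in L$ are given, $S_A=\langle s_1,\ldots,s_m\rangle_{O_A}$, $S_B=\langle t_1,\ldots,t_n\rangle_{O_B}$. Alice's secret key is $(a_0,a,o_A)\in S_A\times L^{k_A}\times O_A^{k_A}$, Bob's is $(b,o_B)\in S_B^{k_B}\times O_B^{k_B}$ (with secret $k_A,k_B\ge1$). Put $\alpha=\phi_{(a,o_A)}$, $\beta=\phi_{(b,o_B)}$. Alice publishes $t_i'=\alpha(t_i)$ ($i\le n$) and $p_0=\alpha(a_0)$;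 Bob publishes $s_j'=\beta(s_j)$ ($j\le m$). The shared key is $K=\alpha(\beta(a_0))$. Breaking the protocol means finding $K$ from the public data $s_j,s_j',t_i,t_i',p_0$ (the attacker can evaluate the operations in $O_A\cup O_B$). Generalized HomSP (Homomorphism Search Problem) for $(S_A,S_B)$: given pairs $(s_1,s_1'),\ldots,(s_m,s_m')\in L^2$ for which there are unknown $k_B$, $b$ and $o_B\in O_B^{k_B}$ with $s_i'=\phi_{(b,o_B)}(s_i)$ for all $i\le m$, find $k_B'\in\mathbb{N}$, $b'\in S_B^{k_B'}$ and $o_B'\in O_B^{k_B'}$, defining a magma homomorphism $\phi_{(b',o_B')}:S_A\to(L,O_A)$, such that $\phi_{(b',o_B')}(s_i)=s_i'$ for all $i\le m$. $O_B$-MSP ($O_B$-submagma Membership Search Problem) for $S_B$: given $t_1,\ldots,t_n$ and $c\in S_B$, find an expression $c=T_{O_B}(u_1,\ldots,u_l)$ with $u_1,\ldots,u_l\in\{t_1,\ldots,t_n\}$. *)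

(* Defs.v *)
From mathcomp Require Import all_boot.

Set Implicit Arguments.
Unset Strict Implicit.
Unset Printing Implicit Defensive.

(* A family of binary operations on L is a map op : I -> L -> L -> L; its index
   type I plays the role of the set of labels of the operations. *)

Definition mutually_distributive (L IA IB : Type)
    (opA : IA -> L -> L -> L) (opB : IB -> L -> L -> L) : Prop :=
  forall (i : IA) (j : IB) (x y z : L),
    opA i x (opB j y z) = opB j (opA i x y) (opA i x z) /\
    opB j x (opA i y z) = opA i (opB j x y) (opB j x z).

Inductive tree (I X : Type) : Type :=
| Leaf of X
| Node of I & tree I X & tree I X.

Fixpoint eval (L I X : Type) (op : I -> L -> L -> L) (y : X -> L)
    (T : tree I X) : L :=
  match T with
  | Leaf x => y x
  | Node i T1 T2 => op i (eval op y T1) (eval op y T2)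
  end.

Definition span (L I : Type) (op : I -> L -> L -> L) (k : nat)
    (y : k.-tuple L) (x : L) : Prop :=
  exists T : tree I 'I_k, x = eval op (tnth y) T.

(* x_k *_k ( ... (x_2 *_2 (x_1 *_1 y))): the first entry acts first. *)
Definition phi (L I : Type) (op : I -> L -> L -> L) (k : nat)
    (x : k.-tuple L) (o : k.-tuple I) (y : L) : L :=
  foldl (fun z p => op p.2 p.1 z) y (zip x o).

Definition magma_hom_on (L I : Type) (op : I -> L -> L -> L) (S : L -> Prop)
    (f : L -> L) : Prop :=
  forall (i : I) (x y : L), S x -> S y -> f (op i x y) = op i (f x) (f y).

Record hom_answer (L IB : Type) : Type := HomAnswer {
  ans_len : nat;
  ans_elts : ans_len.-tuple L;
  ans_ops : ans_len.-tuple IB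
}.

(* The first components s_i of the pairs (s_i, s'_i), and the t_i, are part of
   the specification of S_A and S_B: only the s'_i vary. Nothing is required of
   the answer outside the promise. *)
Definition solves_HomSP (L IA IB : Type)
    (opA : IA -> L -> L -> L) (opB : IB -> L -> L -> L) (m n : nat)
    (s : m.-tuple L) (t : n.-tuple L)
    (hom : m.-tuple L -> hom_answer L IB) : Prop :=
  forall s' : m.-tuple L,
    (exists (k : nat) (b : k.-tuple L) (o : k.-tuple IB),
        [/\ 0 < k,
            forall i : 'I_k, span opB t (tnth b i)
          & forall j : 'I_m, tnth s' j = phi opB b o (tnth s j)]) ->
    let f := phi opB (ans_elts (hom s')) (ans_ops (hom s')) in
    [/\ forall i : 'I_(ans_len (hom s')),
          span opB t (tnth (ans_elts (hom s')) i),
        magma_hom_on opA (span opA s) f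
      & forall j : 'I_m, f (tnth s j) = tnth s' j].

Definition solves_MSP (L IB : Type) (opB : IB -> L -> L -> L) (n : nat)
    (t : n.-tuple L) (msp : L -> tree IB 'I_n) : Prop :=
  forall c : L, span opB t c -> c = eval opB (tnth t) (msp c).

(* Attack algorithms with access to both oracles. An element of [attack V] is a
   program whose registers, indexed by V, hold elements of L. It refers to
   elements of L only through registers and can create new ones only by
   evaluating an operation or by a HomSP query, which appends the elements
   b'_1, ..., b'_k to the registers. Lengths, operation labels and expressions
   (trees whose leaves are the indices of the t_i) returned by the oracles can
   be read, hence the dependency of the rest of the program on them. Since L
   and the secret keys do not occur in this type, a program cannot depend on
   them: without such a restriction, the mere existence of a function sending
   the public data to the key would say nothing about the oracles. *)
Inductive attack (IA IB : Type) (m n : nat) (V : Type) : Type :=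
| Return of V
| EvalA of IA & V & V & attack IA IB m n (option V)
| EvalB of IB & V & V & attack IA IB m n (option V)
| QueryHomSP of m.-tuple V
    & (forall k : nat, k.-tuple IB -> attack IA IB m n (V + 'I_k))
| QueryMSP of V & (tree IB 'I_n -> attack IA IB m n V).

Fixpoint run (L IA IB : Type) (opA : IA -> L -> L -> L)
    (opB : IB -> L -> L -> L) (m n : nat)
    (hom : m.-tuple L -> hom_answer L IB) (msp : L -> tree IB 'I_n)
    (V : Type) (reg : V -> L) (p : attack IA IB m n V) : L :=
  match p with
  | Return v => reg v
  | EvalA i v w q =>
      run opA opB hom msp (oapp reg (opA i (reg v) (reg w))) q
  | EvalB j v w q =>
      run opA opB hom msp (oapp reg (opB j (reg v) (reg w))) q
  | QueryHomSP v q =>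
      let a := hom (map_tuple reg v) in
      run opA opB hom msp
        (fun r => match r with inl u => reg u | inr i => tnth (ans_elts a) i end)
        (q (ans_len a) (ans_ops a))
  | QueryMSP v q => run opA opB hom msp reg (q (msp (reg v)))
  end.

Inductive public_item (m n : nat) : Type :=
| Pub_s of 'I_m
| Pub_s' of 'I_m
| Pub_t of 'I_n
| Pub_t' of 'I_n
| Pub_p0.

Definition public_data (L : Type) (m n : nat) (s : m.-tuple L) (t : n.-tuple L)
    (alpha beta : L -> L) (a0 : L) (v : public_item m n) : L :=
  match v with
  | Pub_s j => tnth s j
  | Pub_s' j => beta (tnth s j)
  | Pub_t i => tnth t i
  | Pub_t' i => alpha (tnth t i)
  | Pub_p0 => alpha a0
  end.

Definition breaks_protocol2 (L IA IB : Type) (opA : IA -> L -> L -> L)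
    (opB : IB -> L -> L -> L) (m n : nat) (s : m.-tuple L) (t : n.-tuple L)
    (hom : m.-tuple L -> hom_answer L IB) (msp : L -> tree IB 'I_n)
    (p : attack IA IB m n (public_item m n)) : Prop :=
  forall (kA kB : nat) (a0 : L) (a : kA.-tuple L) (oA : kA.-tuple IA)
         (b : kB.-tuple L) (oB : kB.-tuple IB),
    0 < kA -> 0 < kB ->
    span opA s a0 ->
    (forall i : 'I_kB, span opB t (tnth b i)) ->
    let alpha := phi opA a oA in
    let beta := phi opB b oB in
    run opA opB hom msp (public_data s t alpha beta a0) p = alpha (beta a0).

(* Main.v *)
Require Import Defs.
From mathcomp Require Import all_boot.

Set Implicit Arguments.
Unset Strict Implicit.
Unset Printing Implicit Defensive.

(** By mutual distributivity, [alpha] is an endomorphism of [(L, O_B)] and [beta]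
    one of [(L, O_A)]. Hence the homomorphism [f = phi_(b',o')] found by the
    HomSP oracle from the [s'_j] agrees with [beta] on all of [S_A], and
    [K = alpha (f a0) = phi_(alpha b', o') (alpha a0)]. Here [alpha a0 = p0] is
    public, and [alpha b'_i] is obtained by evaluating at the [t'_i] the
    expression of [b'_i] in the [t_i] found by the MSP oracle. *)

Lemma foldl_map (A B C : Type) (g : C -> B -> C) (h : A -> B) (z : C)
    (l : seq A) :
  foldl g z (map h l) = foldl (fun y a => g y (h a)) z l.
Proof. by elim: l z => //= a l IHl z; rewrite IHl. Qed.

(** Programs name the entries of [b'] only by indices; this brings the fold in [phi] to the list
    that [phi_prog] traverses. *)
Lemma zip_tnth (A B : Type) (k : nat) (x : k.-tuple A) (o : seq B) :
  zip x o = [seq (tnth x p.1, p.2) | p <- zip (ord_tuple k) o].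
Proof.
have {1}-> : (x : seq A) = map (tnth x) (ord_tuple k).
  by rewrite {1}(tuple_map_ord x).
by elim: (tval (ord_tuple k)) o => [|i r IHr] [|j o] //=; rewrite IHr.
Qed.

Section Homomorphisms.

Variables (L I : Type) (op : I -> L -> L -> L) (f : L -> L).
Hypothesis f_hom : forall i x y, f (op i x y) = op i (f x) (f y).

Lemma hom_eval (X : Type) (y : X -> L) (T : tree I X) :
  f (eval op y T) = eval op (f \o y) T.
Proof. by elim: T => //= i T1 IH1 T2 IH2; rewrite f_hom IH1 IH2. Qed.

Lemma hom_foldl (A : Type) (c : A -> L) (d : A -> I) (y : L) (l : seq A) :
  f (foldl (fun z p => op (d p) (c p) z) y l)
    = foldl (fun z p => op (d p) (f (c p)) z) (f y) l.
Proof. by elim: l y => //= p l IHl y; rewrite IHl f_hom. Qed.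

End Homomorphisms.

Lemma phi_hom (L I J : Type) (op : I -> L -> L -> L) (op' : J -> L -> L -> L)
    (op_distr : forall i j x y z,
       op i x (op' j y z) = op' j (op i x y) (op i x z))
    (k : nat) (x : k.-tuple L) (o : k.-tuple I) (j : J) (y z : L) :
  phi op x o (op' j y z) = op' j (phi op x o y) (phi op x o z).
Proof.
rewrite /phi; elim: (zip x o) y z => //= p l IHl y z.
by rewrite op_distr IHl.
Qed.

Lemma magma_hom_on_span_eq (L I : Type) (op : I -> L -> L -> L) (k : nat)
    (y : k.-tuple L) (f g : L -> L) :
    magma_hom_on op (span op y) f -> magma_hom_on op (span op y) g ->
    (forall i, f (tnth y i) = g (tnth y i)) ->
  forall x, span op y x -> f x = g x.
Proof.
move=> f_hom g_hom eq_fg _ [T ->]; elim: T => //= i T1 IH1 T2 IH2.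
have S1 : span op y (eval op (tnth y) T1) by exists T1.
have S2 : span op y (eval op (tnth y) T2) by exists T2.
by rewrite f_hom // g_hom // IH1 IH2.
Qed.

Section Programs.

Variables (IA IB : Type) (m n : nat).

(* Allocating registers changes the type of the registers, so programs are in
   continuation-passing style: the continuation receives the embedding of the
   old registers into the new ones and the register of the result. *)
Fixpoint eval_prog (T : tree IB 'I_n) (V : Type) (leaf : 'I_n -> V)
    (q : forall W : Type, (V -> W) -> W -> attack IA IB m n W) :
    attack IA IB m n V :=
  match T with
  | Leaf i => q _ id (leaf i)
  | Node j T1 T2 =>
      eval_prog T1 leaf (fun W1 e1 w1 =>
        eval_prog T2 (e1 \o leaf) (fun W2 e2 w2 =>
          EvalB j (e2 w1) w2 (q _ (Some \o e2 \o e1) None)))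
  end.

(** The expression obtained for an element in the $t_i$ is evaluated at [leaf], which in the attack
    holds the $t'_i$. The names in [U] do not depend on [V], so [l] survives each allocation and
    only [elt] and [leaf] are transported. *)
Fixpoint phi_prog (U : Type) (l : seq (U * IB)) (V : Type) (elt : U -> V)
    (leaf : 'I_n -> V) (z : V) : attack IA IB m n V :=
  match l with
  | [::] => Return IA IB m n z
  | p :: l' =>
      QueryMSP (elt p.1) (fun T =>
        eval_prog T leaf (fun W e w =>
          EvalB p.2 w (e z)
            (phi_prog l' (Some \o e \o elt) (Some \o e \o leaf)
              None)))
  end.

Definition attack_prog : attack IA IB m n (public_item m n) :=
  QueryHomSP [tuple Pub_s' n j | j < m] (fun k o =>
    phi_prog (zip (ord_tuple k) o) inr
      (fun i => inl (Pub_t' m i)) (inl (Pub_p0 m n))).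

Variables (L : Type) (opA : IA -> L -> L -> L) (opB : IB -> L -> L -> L).
Variables (hom : m.-tuple L -> hom_answer L IB) (msp : L -> tree IB 'I_n).

(** The condition on [q] acts as a postcondition: old values are kept and [w] holds the result. It
    ranges over all [W] because the registers allocated depend on [T]. *)
Lemma run_eval_prog (T : tree IB 'I_n) (V : Type) (leaf : 'I_n -> V)
    (q : forall W : Type, (V -> W) -> W -> attack IA IB m n W)
    (reg : V -> L) (y : 'I_n -> L) (c : L) :
    (forall i, reg (leaf i) = y i) ->
    (forall W (e : V -> W) w (reg' : W -> L),
       (forall v, reg' (e v) = reg v) -> reg' w = eval opB y T ->
       run opA opB hom msp reg' (q _ e w) = c) ->
  run opA opB hom msp reg (eval_prog T leaf q) = c.
Proof.
elim: T V leaf q reg => [i|j T1 IH1 T2 IH2] V leaf q reg reg_leaf q_run /=.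
  exact: q_run.
apply: IH1 => // W1 e1 w1 reg1 reg_e1 reg_w1.
apply: IH2 => [i|W2 e2 w2 reg2 reg_e2 reg_w2] /=; first by rewrite reg_e1.
by apply: q_run => [v|] /=; rewrite reg_e2 ?reg_e1 // reg_w1 reg_w2.
Qed.

Lemma run_phi_prog (U : Type) (l : seq (U * IB)) (V : Type) (elt : U -> V)
    (leaf : 'I_n -> V) (z : V) (reg : V -> L) (x : U -> L) (y : 'I_n -> L) :
    (forall u, reg (elt u) = x u) -> (forall i, reg (leaf i) = y i) ->
  run opA opB hom msp reg (phi_prog l elt leaf z)
    = foldl (fun c p => opB p.2 (eval opB y (msp (x p.1))) c) (reg z) l.
Proof.
elim: l V elt leaf z reg => //= p l IHl V elt leaf z reg reg_elt reg_leaf.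
rewrite reg_elt; apply: (run_eval_prog (y := y)) => // W e w reg' reg_e reg_w.
rewrite /= IHl /= => [|u|i]; last 2 first.
- by rewrite reg_e.
- by rewrite reg_e.
by rewrite reg_w reg_e.
Qed.

End Programs.

Theorem proposition4p2 (m n : nat) (IA IB : Type)
    (hIA : inhabited IA) (hIB : inhabited IB) :
  exists p : attack IA IB m n (public_item m n),
    forall (L : Type) (opA : IA -> L -> L -> L) (opB : IB -> L -> L -> L)
           (s : m.-tuple L) (t : n.-tuple L)
           (hom : m.-tuple L -> hom_answer L IB) (msp : L -> tree IB 'I_n),
      mutually_distributive opA opB ->
      solves_HomSP opA opB s t hom ->
      solves_MSP opB t msp ->
      breaks_protocol2 opA opB s t hom msp p.
Proof.
exists (attack_prog IA IB m n).
move=> L opA opB s t hom msp distr homP mspP kA kB a0 a oA b oB _ kB_gt0 a0S bS.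
move=> alpha beta.
have alpha_hom j x y : alpha (opB j x y) = opB j (alpha x) (alpha y).
  by apply: phi_hom => i j' u v w; case: (distr i j' u v w).
have beta_hom i x y : beta (opA i x y) = opA i (beta x) (beta y).
  by apply: phi_hom => j i' u v w; case: (distr i' j u v w).
rewrite /=; set s' := map_tuple _ _.
have s'E j : tnth s' j = beta (tnth s j) by rewrite tnth_map tnth_mktuple.
(* Bob's own key witnesses the promise of the HomSP oracle. *)
have [|b'S f_hom f_s] := homP s'; first by exists kB, b, oB.
set b' := ans_elts (hom s') in b'S f_hom f_s *.
set o' := ans_ops (hom s') in f_hom f_s *.
have -> : beta a0 = phi opB b' o' a0.
  apply: magma_hom_on_span_eq a0S => [i x y _ _| |j] //.
  by rewrite f_s s'E.
rewrite (run_phi_prog _ _ _ _ _ _ (x := tnth b') (y := alpha \o tnth t)) //=.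
(* Moving [alpha] inside the fold makes both sides folds over the same list from [alpha a0]. *)
rewrite /phi zip_tnth foldl_map /= (hom_foldl alpha_hom).
(* The two folds agree at each step: evaluating the expression of $b'_i$ at the $t'_i$ gives [alpha]
   of $b'_i$, where [b'S] supplies the promise of the MSP oracle. *)
elim: (zip _ _) (alpha a0) => //= p l IHl c.
by rewrite IHl -(hom_eval alpha_hom) -mspP.
Qed.
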